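(* Let $f_i:\mathbb R^d\to\mathbb R$ be $\mu_i$-strongly convex and $L_i$-smooth, let $h_i=f_i+Q$ where $Q$ is a quadratic function with Hessian $\eta_QI$ ($\eta_Q\ge0$), let $y_i\in\mathbb R^d$, and let $$q_i(x)=h_i(y_i)+\langle\nabla h_i(y_i),x-y_i\rangle+\tfrac{\eta_i}{2}\|x-y_i\|^2,\qquad \eta_i=\tfrac{\mu_i+L_i}{2}+\eta_Q ,$$ be the legacy of $h_i$ at anchor $y_i$. Then for all $x\in\mathbb R^d$ $$\|\nabla q_i(x)-\nabla h_i(x)\|\le\tfrac{L_i-\mu_i}{2}\|x-y_i\| ,$$ and the inherited part is reproduced exactly, i.e. $q_i=q_{f_i}+Q$ identically, where $q_{f_i}(x)=f_i(y_i)+\langle\nabla f_i(y_i),x-y_i\rangle+\frac{\mu_i+L_i}{4}\|x-y_i\|^2$. Hence chained departures accumulate surrogate error only once per original function: in the departure process of the context, for all $x\in\mathbb{R}^d$, $$\|\nabla F(x)-\nabla\widehat F_k(x)\|\le\sum_{m=1}^k\tfrac{L_{i_m}-\mu_{i_m}}{2}\,\|x-y_{i_m}\| .$$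
   Context: **Departure process.** $f_1,\dots,f_n:\mathbb R^d\to\mathbb R$, each $f_i$ being $\mu_i$-strongly convex and $L_i$-smooth, $0<\mu_i\le L_i$; $F=\sum_{i=1}^nf_i$. Distinct nodes $i_1,\dots,i_k$ ($k<n$) depart in this order; $S_m=[n]\setminus\{i_1,\dots,i_m\}$. Each present node $j$ has a working function $h_j$ and a curvature ledger $\eta_j^{\mathrm{led}}$; initially $h_j=f_j$, $\eta_j^{\mathrm{led}}=0$. At the $m$-th departure, node $i=i_m$ fixes an anchor $y_i\in\mathbb R^d$, sets $\eta_i=\frac{\mu_i+L_i}{2}+\eta_i^{\mathrm{led}}$ and forms the legacy $q_i(x)=h_i(y_i)+\langle\nabla h_i(y_i),x-y_i\rangle+\frac{\eta_i}{2}\|x-y_i\|^2$ of its current working function; a single heir $a\in S_m$ then updates $h_a\leftarrow h_a+q_i$, $\eta_a^{\mathrm{led}}\leftarrow\eta_a^{\mathrm{led}}+\eta_i$. Heirs may themselves depart later (chained departures). After $k$ departures, $\widehat F_k=\sum_{j\in S_k}h_j$. *)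

(* Defs.v *)
From mathcomp Require Import all_boot all_order all_algebra.
From mathcomp Require Import all_classical all_reals all_analysis.
Export numFieldNormedType.Exports.

Set Implicit Arguments.
Unset Strict Implicit.
Unset Printing Implicit Defensive.

Import Order.TTheory GRing.Theory Num.Theory.

Local Open Scope ring_scope.

Section Euclidean.
Context {R : realType} {d : nat}.
Implicit Types (f : 'rV[R]_d -> R) (x y : 'rV[R]_d).

Definition dotv x y : R := \sum_(j < d) x 0 j * y 0 j.

(* The norm `|x| that the library puts on row vectors is the max norm (with the
   same topology, hence the same derivatives); the Euclidean norm is needed. *)
Definition norm2 x : R := Num.sqrt (dotv x x).

(* 'D_v is total: grad and hessian are meaningful only where the corresponding
   derivatives exist. *)
Definition grad f x : 'rV[R]_d := \row_j 'D_(delta_mx 0 j) f x.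

Definition hessian f x : 'M[R]_d :=
  \matrix_(i, j) 'D_(delta_mx 0 i) (fun z => grad f z 0 j) x.

Definition strongly_convex (mu : R) f : Prop :=
  forall x y (t : R), 0 <= t <= 1 ->
    f (t *: x + (1 - t) *: y) <=
      t * f x + (1 - t) * f y - mu / 2 * t * (1 - t) * norm2 (x - y) ^+ 2.

Definition smooth (L : R) f : Prop :=
  (forall x, differentiable f x) /\
  (forall x y, norm2 (grad f x - grad f y) <= L * norm2 (x - y)).

(* Polynomials of degree at most 2. *)
Definition quadratic f : Prop :=
  exists (c : R) (b : 'rV[R]_d) (A : 'M[R]_d),
    forall x, f x = c + dotv b x + dotv (x *m A) x.

Definition legacy (h : 'rV[R]_d -> R) y (eta : R) x : R :=
  h y + dotv (grad h y) (x - y) + eta / 2 * norm2 (x - y) ^+ 2.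

End Euclidean.

Section DepartureProcess.
Context {R : realType} {d n : nat}.

Record state := State {
  work : 'I_n -> 'rV[R]_d -> R;
  ledger : 'I_n -> R
}.

Record departure := Departure {
  node : 'I_n;
  anchor : 'rV[R]_d;
  heir : 'I_n
}.

Definition init_state (f : 'I_n -> 'rV[R]_d -> R) : state :=
  State f (fun=> 0).

Definition dep_eta (mu L : 'I_n -> R) (s : state) (i : 'I_n) : R :=
  (mu i + L i) / 2 + ledger s i.

(* The entries of a departed node stay in the state, but are never used again
   when departing nodes are distinct and heirs are present. *)
Definition depart (mu L : 'I_n -> R) (s : state) (e : departure) : state :=
  let eta := dep_eta mu L s (node e) in
  let q := legacy (work s (node e)) (anchor e) eta in
  State
    (fun j => if j == heir e then fun x => work s j x + q x else work s j)
    (fun j => if j == heir e then ledger s j + eta else ledger s j).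

Definition run mu L (f : 'I_n -> 'rV[R]_d -> R) (es : seq departure) : state :=
  foldl (depart mu L) (init_state f) es.

(* S_m: the nodes remaining after the first m departures. *)
Definition present (es : seq departure) (m : nat) : {set 'I_n} :=
  [set j | j \notin [seq node e | e <- take m es]].

(* The entry of index m (from 0) is the (m+1)-st departure: its heir has to lie
   in S_(m+1). *)
Definition valid_departures k (es : k.-tuple departure) : Prop :=
  uniq [seq node e | e <- es] /\
  forall m : 'I_k, heir (tnth es m) \in present es m.+1.

Definition total_obj (f : 'I_n -> 'rV[R]_d -> R) (x : 'rV[R]_d) : R :=
  \sum_(i < n) f i x.

Definition surrogate mu L (f : 'I_n -> 'rV[R]_d -> R) (es : seq departure)
    (x : 'rV[R]_d) : R :=
  \sum_(j in present es (size es)) work (run mu L f es) j x.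

End DepartureProcess.

Arguments state : clear implicits.
Arguments departure : clear implicits.

(* Main.v *)
(** With [c = (mu + L) / 2], the error of one legacy is
    [grad f y + c (x - y) - grad f x = (L - mu) / 2 (x - y) - D], where
    [D = grad f x - grad f y - mu (x - y)] is the increment of the gradient of
    the convex, [(L - mu)]-smooth function [f - mu / 2 |.|^2].  Cocoercivity,
    [|D|^2 <= (L - mu) <D, x - y>], bounds its norm by [(L - mu) / 2 |x - y|].
    Adding to [f] a quadratic with Hessian [a I], and [a] to the curvature [c],
    adds that same quadratic to the legacy and leaves the error unchanged.  In
    the departure process every working function is [f_j] plus a quadratic whose
    Hessian is [I] times its ledger entry, so the departure of [i] changes the
    gradient of the surrogate by the error of the legacy of [f_i] alone. *)

Require Import Defs.
From mathcomp Require Import all_boot all_order all_algebra.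
From mathcomp Require Import all_classical all_reals all_analysis.
From mathcomp Require Import ring lra.
Import Order.TTheory GRing.Theory Num.Theory.
Local Open Scope ring_scope.

(** * Euclidean inner product and norm *)

Section Dotv.
Context {R : realType} {d : nat}.
Implicit Types (u v w x y : 'rV[R]_d).

Lemma dotvC u v : dotv u v = dotv v u.
Proof. by apply: eq_bigr => j _; rewrite mulrC. Qed.

Lemma dotvDl u v w : dotv (u + v) w = dotv u w + dotv v w.
Proof. by rewrite -big_split; apply: eq_bigr => j _; rewrite mxE mulrDl. Qed.

Lemma dotvZl (a : R) u w : dotv (a *: u) w = a * dotv u w.
Proof. by rewrite mulr_sumr; apply: eq_bigr => j _; rewrite mxE mulrA. Qed.

Lemma dotvDr u v w : dotv w (u + v) = dotv w u + dotv w v.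
Proof. by rewrite !(dotvC w) dotvDl. Qed.

Lemma dotvZr (a : R) u w : dotv w (a *: u) = a * dotv w u.
Proof. by rewrite !(dotvC w) dotvZl. Qed.

Lemma dotv0l w : dotv 0 w = 0.
Proof. by rewrite -(scale0r 0) dotvZl mul0r. Qed.

Lemma dotvNl u w : dotv (- u) w = - dotv u w.
Proof. by rewrite -scaleN1r dotvZl mulN1r. Qed.

Lemma dotvNr u w : dotv w (- u) = - dotv w u.
Proof. by rewrite !(dotvC w) dotvNl. Qed.

Definition dotvE := (dotvDl, dotvDr, dotvNl, dotvNr, dotvZl, dotvZr).

Lemma dotv_delta u j : dotv u (delta_mx 0 j) = u 0 j.
Proof.
rewrite /dotv (bigD1 j) //= mxE !eqxx mulr1 big1 ?addr0 // => i ij.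
by rewrite mxE (negPf ij) andbF mulr0.
Qed.

Lemma dotvv_ge0 u : 0 <= dotv u u.
Proof. by apply: sumr_ge0 => j _; rewrite -expr2 sqr_ge0. Qed.

Lemma dotvv_eq0 u : dotv u u = 0 -> u = 0.
Proof.
move=> /eqP; rewrite psumr_eq0 => [/allP u0|j _]; last by rewrite -expr2 sqr_ge0.
apply/rowP => j; apply/eqP; rewrite mxE.
by have := u0 j (mem_index_enum j); rewrite /= mulf_eq0 orbb.
Qed.

Lemma norm2_ge0 u : 0 <= norm2 u. Proof. exact: sqrtr_ge0. Qed.

Lemma sqr_norm2 u : norm2 u ^+ 2 = dotv u u.
Proof. exact/sqr_sqrtr/dotvv_ge0. Qed.

Lemma norm20 : norm2 (0 : 'rV[R]_d) = 0.
Proof. by rewrite /norm2 dotv0l sqrtr0. Qed.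

Lemma norm2_eq0 u : norm2 u = 0 -> u = 0.
Proof. by move=> u0; apply: dotvv_eq0; rewrite -sqr_norm2 u0 expr0n. Qed.

Lemma norm2N u : norm2 (- u) = norm2 u.
Proof. by rewrite /norm2 !dotvE opprK. Qed.

Lemma norm2Z (a : R) u : 0 <= a -> norm2 (a *: u) = a * norm2 u.
Proof.
by move=> a0; rewrite /norm2 !dotvE mulrA sqrtrM ?mulr_ge0 // -expr2 sqrtr_sqr ger0_norm.
Qed.

(** Expanding [|(|v| u - |u| v)|^2 >= 0] and dividing by [|u| |v|] gives Cauchy-Schwarz; vanishing
    norms are treated apart. *)
Lemma dotv_le_norm2 u v : dotv u v <= norm2 u * norm2 v.
Proof.
have [u0|u0] := eqVneq (norm2 u) 0.
  by rewrite (norm2_eq0 _ u0) norm20 mul0r dotv0l.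
have [v0|v0] := eqVneq (norm2 v) 0.
  by rewrite (norm2_eq0 _ v0) norm20 mulr0 dotvC dotv0l.
have uv_gt0 : 0 < norm2 u * norm2 v.
  by rewrite mulr_gt0 // lt0r norm2_ge0 andbT.
have := dotvv_ge0 (norm2 v *: u - norm2 u *: v).
rewrite !dotvE (dotvC v u) -!sqr_norm2 => h.
rewrite -(ler_pM2l uv_gt0); nra.
Qed.

Lemma norm2D u v : norm2 (u + v) <= norm2 u + norm2 v.
Proof.
rewrite -(@ler_pXn2r _ 2) ?nnegrE ?addr_ge0 ?norm2_ge0 //.
rewrite sqr_norm2 !dotvE (dotvC v u) -!sqr_norm2.
have := dotv_le_norm2 u v; nra.
Qed.

End Dotv.

(** * Gradients and one-sided derivative estimates *)

Section Gradient.
Context {R : realType} {d : nat}.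
Implicit Types (f g Q : 'rV[R]_d -> R) (x y u v : 'rV[R]_d).

(* Gateaux derivatives linear in the direction: unlike the total [grad], this
   entails that the directional derivatives exist. *)
Definition is_grad f x u := forall v, is_derive x v f (dotv u v).

Lemma is_gradE f x u : is_grad f x u -> grad f x = u.
Proof.
move=> fxu; apply/rowP => j; rewrite mxE.
by rewrite (@derive_val _ _ _ _ _ _ _ (fxu _)) dotv_delta.
Qed.

Lemma differentiable_is_grad f x : differentiable f x -> is_grad f x (grad f x).
Proof.
move=> fx v; apply: DeriveDef; first exact: diff_derivable.
rewrite deriveE // [in LHS](row_sum_delta v) linear_sum.
by apply: eq_bigr => j _; rewrite linearZ /= mxE deriveE // mulrC.
Qed.

Lemma is_gradD f g x u v :
  is_grad f x u -> is_grad g x v -> is_grad (fun z => f z + g z) x (u + v).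
Proof. by move=> fu gv w; rewrite dotvDl; apply: is_deriveD. Qed.

Lemma is_grad_sum (I : Type) (r : seq I) (P : pred I) (F : I -> 'rV[R]_d -> R)
    x (G : I -> 'rV[R]_d) :
  (forall i, P i -> is_grad (F i) x (G i)) ->
  is_grad (fun z => \sum_(i <- r | P i) F i z) x (\sum_(i <- r | P i) G i).
Proof.
move=> FG; elim: r => [|i r IH].
  rewrite big_nil (_ : (fun _ => _) = cst 0); last first.
    by apply/funext => z; rewrite big_nil.
  by move=> v; rewrite dotv0l; exact: is_derive_cst.
rewrite big_cons (_ : (fun _ => _) = (fun z =>
    if P i then F i z + \sum_(j <- r | P j) F j z
    else \sum_(j <- r | P j) F j z)).
  by case: ifP => // /FG FGi; exact: is_gradD.
by apply/funext => z; rewrite big_cons.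
Qed.

(** The difference quotient at [t] is exactly [a + t b]. This differentiates every quadratic
    function below by algebra alone. *)
Lemma is_derive_expand {V : normedModType R} (f : V -> R) (x v : V) (a b : R) :
  (forall t, f (t *: v + x) = f x + t * a + t ^+ 2 * b) -> is_derive x v f a.
Proof.
move=> fE.
have Q : (h^-1 *: ((f \o shift x) (h *: v) - f x) @[h --> 0^'] --> a)%classic.
  have L : (a + h * b @[h --> (0 : R)^'] --> a)%classic.
    have -> : nbhs a = nbhs (a + 0 * b) by rewrite mul0r addr0.
    apply: cvgD; first exact: cvg_cst.
    by apply: cvgMl; exact: nbhs_dnbhs.
  apply: cvg_trans L; apply: near_eq_cvg; near=> h.
  rewrite /= fE; have h0 : h != 0 by near: h; exact: nbhs_dnbhs_neq.
  by rewrite /GRing.scale /=; field.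
by split; [apply/cvg_ex; exists a | exact: cvg_lim].
Unshelve. all: by end_near. Qed.

Lemma is_derive_line f x v (t a : R) :
  is_derive (x + t *: v) v f a -> is_derive t 1 (fun s => f (x + s *: v)) a.
Proof.
suff E : (fun h => h^-1 *: (((fun s => f (x + s *: v)) \o shift t) (h *: 1)
      - f (x + t *: v))) =
    (fun h : R => h^-1 *: ((f \o shift (x + t *: v)) (h *: v) - f (x + t *: v))).
  by case=> df fE; split; rewrite /derivable /derive E.
apply/funext => h /=; congr (_ *: (f _ - _)).
by rewrite [_%:A]mulr1 scalerDl addrCA.
Qed.

(** For small [h > 0] the difference quotient is at most [C + h K], which tends to [C]. *)
Lemma is_derive_le f x v (a C K : R) : is_derive x v f a ->
  (forall t, 0 < t < 1 -> f (x + t *: v) <= f x + t * C + t ^+ 2 * K) -> a <= C.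
Proof.
case=> /[swap] <- df fle.
have L : (C + h * K @[h --> (0 : R)^'+] --> C)%classic.
  have -> : nbhs C = nbhs (C + 0 * K) by rewrite mul0r addr0.
  apply: cvgD; first exact: cvg_cst.
  by apply: cvgMl; exact: cvg_at_right_filter.
have M := cvg_dnbhs_at_right df.
apply: (ler_cvg_to M L); near=> h => /=.
have h0 : 0 < h by [].
have h1 : h < 1 by near: h; exact: nbhs_right_lt.
have := fle h; rewrite h0 h1 => /(_ isT); rewrite addrC => fh.
by rewrite /GRing.scale /= ler_pdivrMl //; lra.
Unshelve. all: by end_near. Qed.

End Gradient.

(** * Quadratics with scalar Hessian, and their legacies *)

Section Quadratic.
Context {R : realType} {d : nat}.
Implicit Types (f Q : 'rV[R]_d -> R) (x y u v b : 'rV[R]_d).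

(** Explicit coefficients make sums of such functions immediate, with no Hessian to compute. *)
Definition iso_quadratic (eta : R) Q := exists (c : R) b,
  forall x, Q x = c + dotv b x + eta / 2 * dotv x x.

Lemma iso_quadratic0 : iso_quadratic 0 (fun=> 0).
Proof. by exists 0, 0 => x; rewrite dotv0l !mul0r !addr0. Qed.

Lemma iso_quadraticD (a a' : R) Q Q' :
  iso_quadratic a Q -> iso_quadratic a' Q' ->
  iso_quadratic (a + a') (fun x => Q x + Q' x).
Proof.
move=> [c [b QE]] [c' [b' QE']]; exists (c + c'), (b + b') => x.
by rewrite QE QE' dotvDl; field.
Qed.

Lemma iso_quadratic_grad (a : R) Q : iso_quadratic a Q -> exists b,
  (forall x, is_grad Q x (b + a *: x)) /\
  (forall x y, Q x = Q y + dotv (b + a *: y) (x - y) + a / 2 * dotv (x - y) (x - y)).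
Proof.
move=> [c [b QE]]; exists b; split=> [x v|x y]; last first.
  by rewrite !QE !dotvE (dotvC y x); field.
apply: (is_derive_expand _ _ _ _ (a / 2 * dotv v v)) => t.
by rewrite !QE !dotvE (dotvC x v); field.
Qed.

Lemma dotv_mulmx u v (A : 'M[R]_d) : dotv (u *m A) v = dotv u (v *m A^T).
Proof.
have E a b : dotv a b = (a *m b^T) 0 0.
  by rewrite mxE; apply: eq_bigr => j _; rewrite mxE.
by rewrite !E trmx_mul trmxK mulmxA.
Qed.

(** [A] may be asymmetric: the Hessian is [A + A^T], and the quadratic form sees only its half, so
    [A + A^T = a I] yields [a / 2 |x|^2]. *)
Lemma quadratic_iso (a : R) Q : quadratic Q ->
  (forall x, hessian Q x = a%:M) -> iso_quadratic a Q.
Proof.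
move=> [c [b [A QE]]] HQ; exists c, b => x.
have gradQ z : grad Q z = b + z *m (A + A^T).
  apply: is_gradE => v.
  apply: (is_derive_expand _ _ _ _ (dotv (v *m A) v)) => t.
  have -> : dotv (b + z *m (A + A^T)) v
      = dotv b v + (dotv (z *m A) v + dotv (v *m A) z).
    rewrite mulmxDr !dotvDl; congr (_ + (_ + _)).
    by rewrite dotv_mulmx trmxK dotvC.
  by rewrite !QE !mulmxDl -!scalemxAl !dotvE; ring.
have AE : A + A^T = a%:M.
  rewrite -(HQ 0); apply/matrixP => i j; rewrite [RHS]mxE.
  apply/esym; apply: (@derive_val _ _ _ _ _ _ _ _).
  apply: (is_derive_expand _ _ _ _ 0) => t.
  rewrite !gradQ mulmxDl -scalemxAl -rowE !mxE; ring.
rewrite QE; congr (_ + _); 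
have : dotv (x *m (A + A^T)) x = 2 * dotv (x *m A) x.
  by rewrite mulmxDr dotvDl (dotv_mulmx _ _ A^T) trmxK dotvC; ring.
rewrite AE mul_mx_scalar dotvZl; lra.
Qed.

Lemma legacyE f y (c : R) x :
  legacy f y c x = f y + dotv (grad f y) (x - y) + c / 2 * dotv (x - y) (x - y).
Proof. by rewrite /legacy sqr_norm2. Qed.

Lemma legacy_iso f y (c : R) : iso_quadratic c (legacy f y c).
Proof.
exists (f y - dotv (grad f y) y + c / 2 * dotv y y), (grad f y - c *: y) => x.
by rewrite legacyE !dotvE (dotvC y x); field.
Qed.

Lemma legacy_is_grad f y (c : R) x :
  is_grad (legacy f y c) x (grad f y + c *: (x - y)).
Proof.
move=> v; apply: (is_derive_expand _ _ _ _ (c / 2 * dotv v v)) => t.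
by rewrite !legacyE !dotvE !(dotvC v) (dotvC y x); field.
Qed.

Lemma add_iso_is_grad f Q (a : R) x : differentiable f x -> iso_quadratic a Q ->
  let h := fun z => f z + Q z in is_grad h x (grad h x).
Proof.
move=> /differentiable_is_grad fx /iso_quadratic_grad[b [Qb _]] h.
by rewrite (is_gradE _ _ _ (is_gradD _ _ _ _ _ fx (Qb x))); exact: is_gradD.
Qed.

(** [Q] equals its own second-order expansion at [y], so its share of the legacy is [Q] itself. *)
Lemma legacyD f Q y (a c : R) : differentiable f y -> iso_quadratic a Q ->
  legacy (fun x => f x + Q x) y (c + a) = (fun x => legacy f y c x + Q x).
Proof.
move=> /differentiable_is_grad fy /iso_quadratic_grad[b [Qb QE]].
apply/funext => x; rewrite !legacyE (is_gradE _ _ _ (is_gradD _ _ _ _ _ fy (Qb y))).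
by rewrite (QE x y) dotvDl; field.
Qed.

Lemma grad_legacyB f Q y (a c : R) x :
  (forall z, differentiable f z) -> iso_quadratic a Q ->
  let h := fun z => f z + Q z in
  grad (legacy h y (c + a)) x - grad h x = grad f y + c *: (x - y) - grad f x.
Proof.
move=> df Qa /=; rewrite legacyD //; have [b [Qb _]] := iso_quadratic_grad _ _ Qa.
rewrite (is_gradE _ _ _ (is_gradD _ _ _ _ _ (legacy_is_grad f y c x) (Qb x))).
rewrite (is_gradE _ _ _ (is_gradD _ _ _ _ _ (differentiable_is_grad _ _ (df x)) (Qb x))).
by rewrite opprD addrACA subrr addr0.
Qed.

End Quadratic.

(** * Quadratic bounds, cocoercivity and the error of one legacy *)

Section Interpolation.
Context {R : realType} {d : nat}.
Implicit Types (f : 'rV[R]_d -> R) (x y u v : 'rV[R]_d).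

Lemma strongly_convex_lower (mu : R) f x y :
  strongly_convex mu f -> differentiable f y ->
  f y + dotv (grad f y) (x - y) + mu / 2 * dotv (x - y) (x - y) <= f x.
Proof.
move=> cf /differentiable_is_grad /(_ (x - y)) fy.
suff : dotv (grad f y) (x - y) <= f x - f y - mu / 2 * dotv (x - y) (x - y) by lra.
(* The factor [t (1 - t)] in strong convexity leaves the term [t^2 mu / 2 |x - y|^2], whence this
   constant. *)
apply: (is_derive_le _ _ _ _ _ (mu / 2 * dotv (x - y) (x - y)) fy) => t /andP[t0 t1].
have := cf x y t; rewrite (ltW t0) (ltW t1) => /(_ isT).
have -> : t *: x + (1 - t) *: y = y + t *: (x - y).
  by rewrite scalerBr scalerBl scale1r addrC -addrA (addrC (- _)).
rewrite sqr_norm2; lra.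
Qed.

(** The claim is [psi 1 <= psi 0]. By Cauchy-Schwarz and the Lipschitz bound, [psi' t = <grad f (x +
    t v) - grad f x, v> - t L |v|^2 <= 0] on []0, 1[]. *)
Lemma smooth_upper (L : R) f x y : 0 <= L -> smooth L f ->
  f y <= f x + dotv (grad f x) (y - x) + L / 2 * dotv (y - x) (y - x).
Proof.
move=> L0 [df Lf]; set v := y - x.
pose psi (t : R) := f (x + t *: v) - t * dotv (grad f x) v - t ^+ 2 * (L / 2 * dotv v v).
have dpsi (t : R) : is_derive t 1 psi
    (dotv (grad f (x + t *: v)) v - dotv (grad f x) v - t * (L * dotv v v)).
  have fd := is_derive_line _ _ _ _ _ (differentiable_is_grad _ _ (df (x + t *: v)) v).
  have qd : is_derive t 1 (fun s => - s * dotv (grad f x) v - s ^+ 2 * (L / 2 * dotv v v))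
      (- dotv (grad f x) v - t * (L * dotv v v)).
    apply: (is_derive_expand _ _ _ _ (- (L / 2 * dotv v v))) => s.
    by rewrite [_%:A]mulr1; field.
  have -> : psi = (fun s => f (x + s *: v)) + (fun s => - s * dotv (grad f x) v
      - s ^+ 2 * (L / 2 * dotv v v)).
    by apply/funext => s; rewrite fctE /psi; ring.
  by apply: (is_derive_eq (is_deriveD fd qd)); rewrite addrA.
suff : psi 1 <= psi 0.
  rewrite /psi scale1r scale0r addr0 /v addrCA subrr addr0; lra.
apply: (@ler0_derive1_nincr _ psi 0 1) => // [t|].
  rewrite in_itv /= => /andP[t0 _]; rewrite derive1E derive_val.
  rewrite -!addrA -opprD opprD addrA -dotvNl -dotvDl subr_le0.
  apply: le_trans (dotv_le_norm2 _ _) _.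
  have := Lf (x + t *: v) x; rewrite addrAC subrr add0r norm2Z ?(ltW t0) // => Lt.
  apply: le_trans (ler_wpM2r (norm2_ge0 v) Lt) _.
  by rewrite -sqr_norm2; lra.
by apply: derivable_within_continuous => t _; exact: ex_derive.
Qed.

(* Both quadratic bounds on [f] are compared at [x - t D] and at [y + t D], which
   gives [(2 t - (L - mu) t^2) |D|^2 <= <D, x - y>] for every [t]; the best [t] is
   [1 / (L - mu)], and if [L = mu] a large [t] forces [D = 0]. *)
Lemma cocoercive (mu L : R) f x y (D := grad f x - grad f y - mu *: (x - y)) :
  mu <= L -> 0 <= L -> strongly_convex mu f -> smooth L f ->
  dotv D D <= (L - mu) * dotv D (x - y).
Proof.
move=> muL L0 cf sf.
have key t : (2 * t - (L - mu) * t ^+ 2) * dotv D D <= dotv D (x - y).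
  have low1 := strongly_convex_lower _ _ (x - t *: D) y cf (sf.1 y).
  have low2 := strongly_convex_lower _ _ (y + t *: D) x cf (sf.1 x).
  have up1 := smooth_upper _ _ x (x - t *: D) L0 sf.
  have up2 := smooth_upper _ _ y (y + t *: D) L0 sf.
  (* Transitivity eliminates the values at the two shifted points; in the sum, [f x] and [f y]
     cancel as well. *)
  have := lerD (le_trans low1 up1) (le_trans low2 up2).
  have E1 : x - t *: D - y = (x - y) - t *: D by rewrite addrAC.
  have E2 : y + t *: D - x = t *: D - (x - y) by rewrite opprB addrCA addrA.
  have E3 : x - t *: D - x = - (t *: D) by rewrite addrAC subrr add0r.
  have E4 : y + t *: D - y = t *: D by rewrite addrAC subrr add0r.
  rewrite {}E1 {}E2 {}E3 {}E4.
  have gE : grad f x = D + grad f y + mu *: (x - y) by rewrite /D addrAC !subrK.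
  rewrite gE; move: (grad f y) (f x) (f y) (x - y) (D) => q fx fy u w.
  rewrite !dotvE (dotvC w u); lra.
have Du_ge0 : 0 <= dotv D (x - y) by have := key 0; lra.
have [->|D0] := eqVneq (dotv D D) 0; first by rewrite mulr_ge0 // subr_ge0.
have D_gt0 : 0 < dotv D D by rewrite lt0r D0 dotvv_ge0.
have [LmuE|Lmu0] := eqVneq (L - mu) 0.
  (* For [L = mu] this [t] turns [key] into [2 (<D, x - y> + 1) <= <D, x - y>], against [Du_ge0]. *)
  have := key ((dotv D (x - y) + 1) / dotv D D).
  rewrite LmuE mul0r subr0 mulrA divfK //; lra.
have Lmu_gt0 : 0 < L - mu by rewrite lt0r Lmu0 subr_ge0.
have := key (L - mu)^-1.
have -> : 2 * (L - mu)^-1 - (L - mu) * (L - mu)^-1 ^+ 2 = (L - mu)^-1 by field.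
by rewrite ler_pdivrMl.
Qed.

Lemma legacy_error (mu L : R) f x y :
  mu <= L -> 0 <= L -> strongly_convex mu f -> smooth L f ->
  norm2 (grad f y + ((mu + L) / 2) *: (x - y) - grad f x)
    <= (L - mu) / 2 * norm2 (x - y).
Proof.
move=> muL L0 cf sf; have := cocoercive _ _ _ x y muL L0 cf sf.
set D := (_ - _ - _) => coc.
have -> : grad f y + ((mu + L) / 2) *: (x - y) - grad f x
    = ((L - mu) / 2) *: (x - y) - D.
  rewrite /D; move: (grad f x) (grad f y) (x - y) => p q u.
  by apply/rowP => j; rewrite !mxE; field.
move: D (x - y) coc => D u coc.
have Lmu : 0 <= L - mu by rewrite subr_ge0.
(* After squaring, the right side minus the left is [(L - mu) <D, u> - |D|^2], nonnegative by
   [coc]. *)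
rewrite -(@ler_pXn2r _ 2) ?nnegrE ?mulr_ge0 ?norm2_ge0 //.
rewrite exprMn !sqr_norm2 !dotvE (dotvC u D); nra.
Qed.

End Interpolation.

(** * Error accumulation along the departures *)

Section Process.
Context {R : realType} {d n : nat}.
Variables (f : 'I_n -> 'rV[R]_d -> R) (mu L : 'I_n -> R).
Implicit Types (es : seq (departure R d n)) (x : 'rV[R]_d).

Lemma run_rcons es e : run mu L f (rcons es e) = depart mu L (run mu L f es) e.
Proof. exact: foldl_rcons. Qed.

(** An heir receives a legacy of Hessian [eta I] while its ledger grows by the same [eta], so the
    invariant survives each departure. *)
Lemma work_decomp es j : exists2 Q,
  iso_quadratic (ledger (run mu L f es) j) Q &
  work (run mu L f es) j = (fun x => f j x + Q x).
Proof.
elim/last_ind: es => [|es e [Q Qiso workE]].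
  by exists (fun=> 0); [exact: iso_quadratic0 | apply/funext => x; rewrite addr0].
rewrite run_rcons /=; case: ifP => _; last by exists Q.
set q := legacy _ _ _; exists (fun x => Q x + q x).
  by apply: iso_quadraticD => //; exact: legacy_iso.
by apply/funext => x; rewrite workE -addrA.
Qed.

Hypothesis muL : forall i, 0 < mu i /\ mu i <= L i.
Hypothesis csf : forall i, strongly_convex (mu i) (f i) /\ smooth (L i) (f i).

Lemma work_is_grad es j x :
  is_grad (work (run mu L f es) j) x (grad (work (run mu L f es) j) x).
Proof.
have [Q Qiso ->] := work_decomp es j.
by apply: add_iso_is_grad Qiso; exact: (csf j).2.1.
Qed.

Lemma grad_surrogate es x : grad (surrogate mu L f es) x =
  \sum_(j in present es (size es)) grad (work (run mu L f es) j) x.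
Proof. by apply: is_gradE; apply: is_grad_sum => j _; exact: work_is_grad. Qed.

Lemma present_rcons es e :
  present (rcons es e) (size (rcons es e)) = present es (size es) :\ node e.
Proof.
by apply/setP => j; rewrite !inE !take_size map_rcons mem_rcons inE negb_or.
Qed.

(** Induction on the last departure, over plain sequences rather than tuples. Each departure shifts
    the surrogate gradient by one legacy error, and the triangle inequality adds them up. *)
Lemma surrogate_error es x :
  uniq (map node es) ->
  (forall e0 m, (m < size es)%N -> heir (nth e0 es m) \in present es m.+1) ->
  norm2 (grad (total_obj f) x - grad (surrogate mu L f es) x) <=
    \sum_(e <- es) (L (node e) - mu (node e)) / 2 * norm2 (x - anchor e).
Proof.
elim/last_ind: es => [_ _|es e IH].
  rewrite big_nil (_ : surrogate mu L f [::] = total_obj f) ?subrr ?norm20 //.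
  by apply/funext => z; apply: eq_bigl => j; rewrite inE.
rewrite map_rcons rcons_uniq => /andP[e_notin es_uniq] heirs.
have {}IH : norm2 (grad (total_obj f) x - grad (surrogate mu L f es) x) <=
    \sum_(e <- es) (L (node e) - mu (node e)) / 2 * norm2 (x - anchor e).
  (* Since [m < size es], the first [m + 1] departures do not involve [e], so the present sets
     agree. *)
  apply: IH => // e0 m m_lt; have := heirs e0 m; rewrite size_rcons ltnS (ltnW m_lt).
  by rewrite nth_rcons m_lt !inE -cats1 takel_cat // => /(_ isT).
have eS : node e \in present es (size es) by rewrite inE take_size.
have : heir e \in present es (size es) :\ node e.
  have := heirs e (size es); rewrite -present_rcons size_rcons ltnSn => /(_ isT).
  by rewrite nth_rcons ltnn eqxx.
set a := heir e; set i := node e => aS.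
set s := run mu L f es.
set q := legacy (work s i) (anchor e) (dep_eta mu L s i).
have [Q Qiso workE] := work_decomp es i.
have q_grad : is_grad q x (grad q x).
  by rewrite (is_gradE _ _ _ (legacy_is_grad _ _ _ x)); exact: legacy_is_grad.
have -> : grad (surrogate mu L f (rcons es e)) x
    = grad (surrogate mu L f es) x + (grad q x - grad (work s i) x).
  (* Isolate the summand of [i], which disappears, and that of the heir [a], which gains [grad q x];
     all others are unchanged. *)
  rewrite !grad_surrogate present_rcons (big_setD1 _ eS) /= -/s -/i.
  rewrite !(big_setD1 _ aS) /= run_rcons /= eqxx -/s -/i -/q.
  rewrite (is_gradE _ _ _ (is_gradD _ _ _ _ _ (work_is_grad es a x) q_grad)) -/s.
  rewrite (eq_bigr (fun j => grad (work s j) x)); last first.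
    by move=> j; rewrite !inE => /andP[/negPf -> _].
  by rewrite [RHS]addrC [RHS]addrA subrK addrA [grad q x + _]addrC.
have err : norm2 (grad q x - grad (work s i) x) <=
    (L i - mu i) / 2 * norm2 (x - anchor e).
  (* The ledger entry is exactly the curvature of the inherited [Q], so [Q] cancels and only the
     error of [f i] remains. *)
  rewrite /q /dep_eta workE grad_legacyB //; last exact: (csf i).2.1.
  apply: legacy_error (csf i).1 (csf i).2; first exact: (muL i).2.
  by apply: le_trans (muL i).2; exact/ltW/(muL i).1.
rewrite big_rcons /= opprD addrA; apply: le_trans (norm2D _ _) _.
by rewrite norm2N lerD.
Qed.

End Process.

Theorem proposition5 (R : realType) (d : nat) :
  (forall (f Q : 'rV[R]_d -> R) (mu L etaQ : R) (y : 'rV[R]_d),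
     0 < mu -> mu <= L ->
     strongly_convex mu f -> smooth L f ->
     0 <= etaQ -> quadratic Q -> (forall x, hessian Q x = etaQ%:M) ->
     let h := fun x => f x + Q x in
     let eta := (mu + L) / 2 + etaQ in
     let q := legacy h y eta in
     (forall x, norm2 (grad q x - grad h x) <= (L - mu) / 2 * norm2 (x - y)) /\
     (forall x, q x = (f y + dotv (grad f y) (x - y)
                       + (mu + L) / 4 * norm2 (x - y) ^+ 2) + Q x)) /\
  (forall (n k : nat) (f : 'I_n -> 'rV[R]_d -> R) (mu L : 'I_n -> R)
          (es : k.-tuple (departure R d n)),
     (k < n)%N ->
     (forall i, 0 < mu i /\ mu i <= L i) ->
     (forall i, strongly_convex (mu i) (f i) /\ smooth (L i) (f i)) ->
     valid_departures es ->
     forall x, norm2 (grad (total_obj f) x - grad (surrogate mu L f es) x) <=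
       \sum_(m < k) (L (node (tnth es m)) - mu (node (tnth es m))) / 2
                    * norm2 (x - anchor (tnth es m))).
Proof.
split=> [f Q mu L etaQ y mu0 muL cf sf _ quadQ hessQ h eta q|].
  have Qiso := quadratic_iso _ _ quadQ hessQ.
  split=> x; last first.
    rewrite /q /eta legacyD //; last exact: sf.1.
    by rewrite /legacy; congr (_ + _ * _ + _); field.
  rewrite grad_legacyB //; last exact: sf.1.
  by apply: legacy_error => //; apply: le_trans muL; exact: ltW.
move=> n k f mu L es _ muL csf [es_uniq heirs] x.
(* Within bounds the default [e0] is irrelevant, so tuple access becomes [nth]. *)
have heirs' e0 m : (m < size es)%N -> heir (nth e0 es m) \in present es m.+1.
  rewrite size_tuple => mk.
  by have := heirs (Ordinal mk); rewrite (tnth_nth e0).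
apply: le_trans (surrogate_error _ _ _ muL csf es x es_uniq heirs') _.
by rewrite big_tuple.
Qed.
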